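(* Let $\mathcal V$ be a variety with a difference term $p(x,y,z)$, and let $q(x,y,z,w):=p(p(x,z,z),p(y,w,z),z)$. Let $\mathbf A\in\mathcal V$ and $\alpha,\beta\in\mathrm{Con}(\mathbf A)$ with $[\alpha,\beta]=0$. Then the map $R(\alpha,\beta)\to A$, $(a,b,c,d)\mapsto q(a,b,c,d)$, is a homomorphism from the subalgebra $R(\alpha,\beta)$ of $\mathbf A^4$ to $\mathbf A$.
   Context: $[\alpha,\beta]$ denotes the (term-condition) commutator of congruences. A (3-ary) difference term for a variety $\mathcal V$ is a ternary term $p$ such that $p(x,x,y)\approx y$ holds in $\mathcal V$ and $p(a,b,b)\equiv a \pmod{[\theta,\theta]}$ whenever $(a,b)\in\theta\in\mathrm{Con}(\mathbf A)$, $\mathbf A\in\mathcal V$. For an algebra $\mathbf A$ and $\alpha,\beta\in\mathrm{Con}(\mathbf A)$, $R(\alpha,\beta)=\{(a,b,c,d)\in A^4: (a,b),(c,d)\in\alpha,\ (a,c),(b,d)\in\beta\}$, which is a subalgebra of $\mathbf A^4$. *)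

(* Defs.v *)
From mathcomp Require Import all_boot.
Set Implicit Arguments. Unset Strict Implicit. Unset Printing Implicit Defensive.

Record signature := Signature { symb : Type; arity : symb -> nat }.

Record algebra (S : signature) := Algebra {
  carrier :> Type;
  op : forall f : symb S, ('I_(arity f) -> carrier) -> carrier }.

Inductive term (S : signature) (X : Type) : Type :=
| Var : X -> term S X
| App : forall f : symb S, ('I_(arity f) -> term S X) -> term S X.

Fixpoint eval (S : signature) (A : algebra S) (X : Type) (env : X -> A)
  (t : term S X) : A :=
  match t with
  | Var x => env x
  | App f args => @op S A f (fun i => eval env (args i))
  end.

(* Identities (over countably many variables) and models: a variety is the
   class of models of a set of identities (Birkhoff). *)
Definition identity (S : signature) := (term S nat * term S nat)%type.

Definition models (S : signature) (A : algebra S) (Sigma : identity S -> Prop) :=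
  forall e, Sigma e -> forall env : nat -> A, eval env e.1 = eval env e.2.

Definition is_congruence (S : signature) (A : algebra S) (th : A -> A -> Prop) :=
  [/\ (forall x, th x x),
      (forall x y, th x y -> th y x),
      (forall x y z, th x y -> th y z -> th x z) &
      (forall f (a b : 'I_(arity f) -> A),
          (forall i, th (a i) (b i)) -> th (@op S A f a) (@op S A f b))].

Definition sumenv (A : Type) (m n : nat) (a : 'I_m -> A) (c : 'I_n -> A)
  : 'I_m + 'I_n -> A :=
  fun v => match v with inl i => a i | inr j => c j end.

Definition centralizes (S : signature) (A : algebra S)
  (al be de : A -> A -> Prop) :=
  forall (m n : nat) (t : term S ('I_m + 'I_n)) (a b : 'I_m -> A) (c d : 'I_n -> A),
    (forall i, al (a i) (b i)) -> (forall j, be (c j) (d j)) ->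
    de (eval (sumenv a c) t) (eval (sumenv a d) t) ->
    de (eval (sumenv b c) t) (eval (sumenv b d) t).

(* The term-condition commutator [alpha, beta]: the least congruence delta
   with C(alpha, beta; delta), i.e. the intersection of all such. *)
Definition commutator (S : signature) (A : algebra S) (al be : A -> A -> Prop)
  (x y : A) : Prop :=
  forall de, @is_congruence S A de -> @centralizes S A al be de -> de x y.

Definition env3 (A : Type) (x y z : A) : 'I_3 -> A :=
  fun i => match val i with 0 => x | 1 => y | _ => z end.

Definition eval3 (S : signature) (A : algebra S) (p : term S 'I_3) (x y z : A) : A :=
  eval (env3 x y z) p.

Definition is_difference_term (S : signature) (Sigma : identity S -> Prop)
  (p : term S 'I_3) :=
  forall B : algebra S, @models S B Sigma ->
    (forall x y : B, eval3 p x x y = y) /\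
    (forall th : B -> B -> Prop, @is_congruence S B th ->
       forall a b : B, th a b -> @commutator S B th th (eval3 p a b b) a).

Definition qmap (S : signature) (A : algebra S) (p : term S 'I_3) (x y z w : A) : A :=
  eval3 p (eval3 p x z z) (eval3 p y w z) z.

Definition inR (A : Type) (al be : A -> A -> Prop) (a b c d : A) :=
  [/\ al a b, al c d, be a c & be b d].

(* Main.v *)
Require Import Defs.
From mathcomp Require Import all_boot.
From Stdlib Require Import FunctionalExtensionality ProofIrrelevance.
Set Implicit Arguments. Unset Strict Implicit. Unset Printing Implicit Defensive.

(** The matrices [[t(a,c), t(a,d)], [t(b,c), t(b,d)]] with [a al b] and
    [c be d] form a compatible 4-ary relation, in which by [[al, be] = 0] a
    matrix with a constant row has both rows constant.  The difference term
    shows that this uniqueness property survives transposition and pasting two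
    matrices along a common column.  Iterating the two gives a relation [T]
    with the uniqueness property that is transitive in both directions.

    Consider the subalgebra [al] of [A^2], its congruence
    [B = (be x be)] and its congruence [D] given by [T], whose elements are the
    columns.  Every [B]-pair [(a1, a2), (b1, b2)] is linked by
    [(a1, a2), (a2, a2), (b2, b2), (b1, b2)], where the middle step lies in [D]
    and the outer ones change one coordinate inside [al]; hence [B]
    centralizes itself modulo [D].  So [[B, B] <= D], and the difference
    term property in the algebra [al] puts the matrix with columns
    [(a, b)] and [(q(a,b,c,d), d)] in [T].  By uniqueness this determines
    [q(a,b,c,d)], and compatibility of [T] makes [q] a homomorphism. *)

(** * Terms, congruences and the commutator *)

Section Terms.
Variables (S : signature) (A : algebra S).

Fixpoint rename (X Y : Type) (g : X -> Y) (t : term S X) : term S Y :=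
  match t with
  | Var x => Var S (g x)
  | App f args => App (fun i => rename g (args i))
  end.

Lemma eval_rename (X Y : Type) (g : X -> Y) (env : Y -> A) (t : term S X) :
  eval env (rename g t) = eval (fun x => env (g x)) t.
Proof.
elim: t => //= f args IH; congr op.
by apply: functional_extensionality => i; exact: IH.
Qed.

Lemma eval_ext (X : Type) (env env' : X -> A) (t : term S X) :
  env =1 env' -> eval env t = eval env' t.
Proof.
by move=> e; congr (eval _ t); apply: functional_extensionality.
Qed.

Lemma congruence_eval (X : Type) (th : A -> A -> Prop) (e e' : X -> A)
    (t : term S X) :
  is_congruence th -> (forall v, th (e v) (e' v)) -> th (eval e t) (eval e' t).
Proof.
by case=> _ _ _ thop he; elim: t => [v|f args IH] /=; [exact: he | exact: thop].
Qed.

Lemma congruence_eval3 (th : A -> A -> Prop) (p : term S 'I_3)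
    (x y z x' y' z' : A) :
  is_congruence th -> th x x' -> th y y' -> th z z' ->
  th (eval3 p x y z) (eval3 p x' y' z').
Proof.
by move=> cth hx hy hz; apply: congruence_eval => // -[[|[|k]] lt_k].
Qed.

(** A term condition for the larger pair of relations restricts to the smaller one, so the smaller
    pair has at least as many [de] to intersect. *)
Lemma commutator_mono (al be al' be' : A -> A -> Prop) (x y : A) :
  (forall u v, al' u v -> al u v) -> (forall u v, be' u v -> be u v) ->
  commutator al' be' x y -> commutator al be x y.
Proof.
move=> sal sbe h de cde zde; apply: h => // m n t a b c d hab hcd.
by apply: zde => i; [exact: sal | exact: sbe].
Qed.

End Terms.

(** * Matrix systems: transposition and pasting *)

Section Matrices.
Variables (S : signature) (A : algebra S).

(* Throughout, [x y z w] is the matrix with columns [(x, y)] and [(z, w)],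
   as in [inR]: columns are pairs in [al], rows are pairs in [be]. *)
Record matrix_of (al be : A -> A -> Prop) (x y z w : A) := MatrixOf {
  mat_m : nat;
  mat_n : nat;
  mat_t : term S ('I_mat_m + 'I_mat_n);
  mat_a : 'I_mat_m -> A;
  mat_b : 'I_mat_m -> A;
  mat_c : 'I_mat_n -> A;
  mat_d : 'I_mat_n -> A;
  mat_al : forall i, al (mat_a i) (mat_b i);
  mat_be : forall j, be (mat_c j) (mat_d j);
  mat_x : x = eval (sumenv mat_a mat_c) mat_t;
  mat_y : y = eval (sumenv mat_b mat_c) mat_t;
  mat_z : z = eval (sumenv mat_a mat_d) mat_t;
  mat_w : w = eval (sumenv mat_b mat_d) mat_t }.

Definition matrices (al be : A -> A -> Prop) (x y z w : A) : Prop :=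
  inhabited (matrix_of al be x y z w).

Record matrix_system (al be : A -> A -> Prop)
    (T : A -> A -> A -> A -> Prop) : Prop := MatrixSystem {
  ms_inR : forall x y z w, T x y z w -> inR al be x y z w;
  ms_al : forall x y, al x y -> T x y x y;
  ms_be : forall x z, be x z -> T x x z z;
  ms_op : forall (f : symb S) (a b c d : 'I_(arity f) -> A),
    (forall i, T (a i) (b i) (c i) (d i)) ->
    T (@op S A f a) (@op S A f b) (@op S A f c) (@op S A f d);
  ms_rows : forall x y z w, T x y z w -> T y x w z;
  ms_cols : forall x y z w, T x y z w -> T z w x y;
  ms_uniq : forall x y y', T x y x y' -> y = y' }.

(** The argument matrices may use different terms with different numbers of variables. Their
    variables are made disjoint by indexing them with the finite sums [I] and [J], and [f] is
    applied to the renamed terms. *)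
Lemma matrices_op (al be : A -> A -> Prop) (f : symb S)
    (a b c d : 'I_(arity f) -> A) :
  (forall i, matrices al be (a i) (b i) (c i) (d i)) ->
  matrices al be (@op S A f a) (@op S A f b) (@op S A f c) (@op S A f d).
Proof.
move=> H.
(* Finite choice of the witnessing data; the predicate [True] is a dummy. *)
have [D _] : exists D : forall i, matrix_of al be (a i) (b i) (c i) (d i),
    forall i : 'I_(arity f), True.
  apply: (fin_all_exists (P := fun _ _ => True)) => i.
  by case: (H i) => D; exists D.
pose I : finType := {i & 'I_(mat_m (D i))}.
pose J : finType := {i & 'I_(mat_n (D i))}.
pose g i (v : 'I_(mat_m (D i)) + 'I_(mat_n (D i))) : 'I_#|I| + 'I_#|J| :=
  match v with
  | inl k => inl (enum_rank (Tagged (fun i => 'I_(mat_m (D i))) k))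
  | inr k => inr (enum_rank (Tagged (fun i => 'I_(mat_n (D i))) k))
  end.
pose iI (k : 'I_#|I|) : I := enum_val k; pose jJ (k : 'I_#|J|) : J := enum_val k.
constructor; exists #|I| #|J| (App (fun i => rename (@g i) (mat_t (D i))))
  (fun k => mat_a (tagged (iI k))) (fun k => mat_b (tagged (iI k)))
  (fun k => mat_c (tagged (jJ k))) (fun k => mat_d (tagged (jJ k))).
- by move=> k; exact: (mat_al (tagged (iI k))).
- by move=> k; exact: (mat_be (tagged (jJ k))).
all: rewrite /=; congr op; apply: functional_extensionality => i.
all: rewrite eval_rename.
1: apply: etrans (mat_x (D i)) _. 2: apply: etrans (mat_y (D i)) _.
3: apply: etrans (mat_z (D i)) _. 4: apply: etrans (mat_w (D i)) _.
all: by apply: eval_ext => -[k|k] /=; rewrite ?/iI ?/jJ enum_rankK.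
Qed.

Lemma matrices_system (al be : A -> A -> Prop) :
  is_congruence al -> is_congruence be ->
  (forall x y, commutator al be x y -> x = y) ->
  matrix_system al be (matrices al be).
Proof.
move=> cal cbe com0.
have [al_refl al_sym _ _] := cal; have [be_refl be_sym _ _] := cbe.
split.
- move=> _ _ _ _ [[m n t a b c d hab hcd -> -> -> ->]].
  by split; apply: congruence_eval => // -[k|k] /=.
- move=> x y xy; constructor.
  by exists 1 0 (Var S (inl ord0)) (fun=> x) (fun=> y) (fun=> x) (fun=> x).
- move=> x z xz; constructor.
  by exists 0 1 (Var S (inr ord0)) (fun=> x) (fun=> x) (fun=> x) (fun=> z).
- exact: matrices_op.
- move=> x y z w [[m n t a b c d hab hcd ex ey ez ew]].
  by constructor; exists m n t b a c d => // i; exact: al_sym.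
- move=> x y z w [[m n t a b c d hab hcd ex ey ez ew]].
  by constructor; exists m n t a b d c => // i; exact: be_sym.
move=> x y y' [[m n t a b c d hab hcd ex ey ez ew]].
(* The top row is constant, hence in every [de]; the term condition moves this to the bottom row,
   which therefore lies in the commutator. *)
rewrite ey ew; apply: com0 => de cde zde; apply: zde hab hcd _.
by rewrite -ex -ez; case: cde.
Qed.

Lemma ms_eval (al be : A -> A -> Prop) (T : A -> A -> A -> A -> Prop)
    (X : Type) (t : term S X) (a b c d : X -> A) :
  matrix_system al be T -> (forall v, T (a v) (b v) (c v) (d v)) ->
  T (eval a t) (eval b t) (eval c t) (eval d t).
Proof.
by move=> msT h; elim: t => [v|f args IH] /=; [exact: h | exact: ms_op msT _ _ _ _ _ IH].
Qed.

Lemma ms_eval3 (al be : A -> A -> Prop) (T : A -> A -> A -> A -> Prop)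
    (p : term S 'I_3) (x y z w x' y' z' w' x'' y'' z'' w'' : A) :
  matrix_system al be T ->
  T x y z w -> T x' y' z' w' -> T x'' y'' z'' w'' ->
  T (eval3 p x x' x'') (eval3 p y y' y'') (eval3 p z z' z'') (eval3 p w w' w'').
Proof.
by move=> msT h h' h''; apply: (ms_eval _ msT) => -[[|[|k]] lt_k].
Qed.

Variable p : term S 'I_3.
Hypothesis p_left : forall x y : A, eval3 p x x y = y.

Lemma matrix_system_tr (al be : A -> A -> Prop) (T : A -> A -> A -> A -> Prop) :
  is_congruence al -> is_congruence be ->
  (forall x y : A, al x y -> be x y -> eval3 p x y y = x) ->
  matrix_system al be T -> matrix_system be al (fun x y z w => T x z y w).
Proof.
move=> [al_refl al_sym al_trans _] [be_refl be_sym be_trans _] p_right msT.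
split=> /=.
- by move=> x y z w /(ms_inR msT)[].
- exact: ms_be msT.
- exact: ms_al msT.
- by move=> f a b c d; exact: (ms_op msT).
- by move=> x y z w; exact: (ms_cols msT).
- by move=> x y z w; exact: (ms_rows msT).
move=> x z z' Txz; have [_ alzz' bexz bexz'] := ms_inR msT Txz.
have bezz' : be z z' by apply: be_trans bexz'; exact: be_sym.
suff /(ms_rows msT)/(ms_uniq msT) : T z' z' z z'.
  by [].
(* Entrywise, p gives p(x,x,z') = z' twice in the first column, and p(z,z',z') = z over p(z',z',z')
   = z' in the second. The bottom row is constant, so the top row z', z is too. *)
have := ms_eval3 p msT Txz (ms_be msT bexz') (ms_al msT (al_refl z')).
by rewrite !p_left (p_right _ _ alzz' bezz').
Qed.

Definition paste (T : A -> A -> A -> A -> Prop) (x y z w : A) : Prop :=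
  exists2 uv : A * A, T x y uv.1 uv.2 & T uv.1 uv.2 z w.

Lemma matrix_system_paste (al be : A -> A -> Prop)
    (T : A -> A -> A -> A -> Prop) :
  is_congruence al -> is_congruence be ->
  (forall x y : A, al x y -> be x y -> eval3 p x y y = x) ->
  matrix_system al be T -> matrix_system al be (paste T).
Proof.
move=> [al_refl al_sym al_trans _] [be_refl be_sym be_trans _] p_right msT.
have sub x y z w : T x y z w -> paste T x y z w.
  move=> h; have [xy _ _ _] := ms_inR msT h.
  by exists (x, y) => //; exact: ms_al msT _ _ xy.
have paste_inR x y z w : paste T x y z w -> inR al be x y z w.
  case=> -[u v] /= /(ms_inR msT)[? ? ? ?] /(ms_inR msT)[? ? ? ?].
  by split=> //; [exact: be_trans (_ : be x u) _ | exact: be_trans (_ : be y v) _].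
split=> //.
- by move=> x y /(ms_al msT)/sub.
- by move=> x z /(ms_be msT)/sub.
- move=> f a b c d H.
  have /fin_all_exists[uv huv] : forall i, exists uv : A * A,
      T (a i) (b i) uv.1 uv.2 /\ T uv.1 uv.2 (c i) (d i).
    by move=> i; have [uv] := H i; exists uv.
  exists (op (fun i => (uv i).1), op (fun i => (uv i).2)) => /=.
    by apply: (ms_op msT) => i; case: (huv i).
  by apply: (ms_op msT) => i; case: (huv i).
- by move=> x y z w [[u v] /= h1 h2]; exists (v, u); exact: (ms_rows msT).
- by move=> x y z w [[u v] /= h1 h2]; exists (u, v); exact: (ms_cols msT).
(* Applying [p] turns every column [(x, y)] into [(s, p(y, x, s))], so that
   the uniqueness property for [T] applies to each factor. *)
have shift x y z w s : T x y z w -> eval3 p y x s = eval3 p w z s.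
  move=> h; have [_ _ xz _] := ms_inR msT h.
  apply: (ms_uniq msT (x := s)).
  have := ms_eval3 p msT h (ms_be msT xz) (ms_al msT (al_refl s)).
  by rewrite !p_left.
move=> x y y' h; have [xy xy' _ yy'] := paste_inR _ _ _ _ h.
have e : eval3 p y x y' = eval3 p y' x y'.
  by case: h => -[u v] /= h1 h2; rewrite (shift _ _ _ _ _ h1) (shift _ _ _ _ _ h2).
have alyy' : al y y' by apply: al_trans xy'; exact: al_sym.
(* The matrix with top row p(y,x,y'), p(y',x,y'), constant by [e], has bottom row p(y,y',y') = y and
   p(y',y',y') = y'. *)
rewrite -(p_right _ _ alyy' yy') -[RHS](p_left y').
apply: (ms_uniq msT (x := eval3 p y x y')).
rewrite {2}e.
exact: ms_eval3 msT (ms_be msT yy') (ms_al msT xy') (ms_al msT (al_refl y')).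
Qed.

(** Pasting along a common column, then, through the transpose, along a common row. *)
Definition paste2 (T : A -> A -> A -> A -> Prop) (x y z w : A) : Prop :=
  paste (fun x z y w => paste T x y z w) x z y w.

Definition closure (T : A -> A -> A -> A -> Prop) (x y z w : A) : Prop :=
  exists n, iter n paste2 T x y z w.

(** * The closure under pasting in both directions *)

Section Closure.
Variables (al be : A -> A -> Prop) (T : A -> A -> A -> A -> Prop).
Hypotheses (cal : is_congruence al) (cbe : is_congruence be).
Hypothesis p_right : forall x y : A, al x y -> be x y -> eval3 p x y y = x.
Hypothesis msT : matrix_system al be T.

Lemma matrix_system_iter n : matrix_system al be (iter n paste2 T).
Proof.
have p_right' (x y : A) : be x y -> al x y -> eval3 p x y y = x.
  by move=> bxy axy; exact: p_right.
elim: n => //= n IH.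
apply: (matrix_system_tr cbe cal p_right' (T := fun x z y w => paste2 _ x y z w)).
apply: matrix_system_paste => //.
by apply: matrix_system_tr => //; exact: matrix_system_paste.
Qed.

Lemma iter_htrans n x y u v z w :
  iter n paste2 T x y u v -> iter n paste2 T u v z w ->
  iter n.+1 paste2 T x y z w.
Proof.
(* The row pasting is made trivial: the upper factor has columns (x, x) and (z, z). *)
move=> h1 h2; exists (x, z) => /=.
  have [_ _ xu _] := ms_inR (matrix_system_iter n) h1.
  have [_ _ uz _] := ms_inR (matrix_system_iter n) h2.
  exists (u, u) => /=; exact: ms_be (matrix_system_iter n) _ _ _.
by exists (u, v).
Qed.

Lemma iter_vtrans n x y z w y' w' :
  iter n paste2 T x y z w -> iter n paste2 T y y' w w' ->
  iter n.+1 paste2 T x y' z w'.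
Proof.
move=> h1 h2; have [xy zw _ _] := ms_inR (matrix_system_iter n) h1.
have [yy' _ _ _] := ms_inR (matrix_system_iter n) h2.
exists (y, w) => /=.
  by exists (x, y) => //=; exact: ms_al (matrix_system_iter n) _ _ _.
by exists (y, y') => //=; exact: ms_al (matrix_system_iter n) _ _ _.
Qed.

Lemma iter_mono m n x y z w :
  m <= n -> iter m paste2 T x y z w -> iter n paste2 T x y z w.
Proof.
move=> le_mn h; rewrite -(subnK le_mn); elim: (n - m) => //= k IH.
have [xy _ _ _] := ms_inR (matrix_system_iter _) IH.
exact: iter_htrans (ms_al (matrix_system_iter _) xy) IH.
Qed.

Lemma closure_htrans x y u v z w :
  closure T x y u v -> closure T u v z w -> closure T x y z w.
Proof.
case=> m h1 [n h2]; exists (maxn m n).+1.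
apply: iter_htrans (iter_mono _ h1) (iter_mono _ h2).
- exact: leq_maxl.
- exact: leq_maxr.
Qed.

Lemma closure_vtrans x y z w y' w' :
  closure T x y z w -> closure T y y' w w' -> closure T x y' z w'.
Proof.
case=> m h1 [n h2]; exists (maxn m n).+1.
apply: iter_vtrans (iter_mono _ h1) (iter_mono _ h2).
- exact: leq_maxl.
- exact: leq_maxr.
Qed.

Lemma matrix_system_closure : matrix_system al be (closure T).
Proof.
split.
- by move=> x y z w [n /(ms_inR (matrix_system_iter n))].
- by move=> x y xy; exists 0; exact: ms_al msT _ _ xy.
- by move=> x z xz; exists 0; exact: ms_be msT _ _ xz.
(* Arities are finite, so all arguments reach a common stage of the increasing chain. *)
- move=> f a b c d /fin_all_exists[n hn]; exists (\max_i n i).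
  apply: (ms_op (matrix_system_iter _)) => i.
  by apply: iter_mono (hn i); exact: leq_bigmax.
- by move=> x y z w [n /(ms_rows (matrix_system_iter n)) h]; exists n.
- by move=> x y z w [n /(ms_cols (matrix_system_iter n)) h]; exists n.
- by move=> x y y' [n /(ms_uniq (matrix_system_iter n))].
Qed.

End Closure.

End Matrices.

(** * The subalgebra [al] of the square of [A] *)

Section Pairs.
Variables (S : signature) (A : algebra S) (al : A -> A -> Prop).
Hypothesis cal : is_congruence al.

Definition pairs : Type := {xy : A * A | al xy.1 xy.2}.

Definition pair_of (x y : A) (xy : al x y) : pairs := exist _ (x, y) xy.

Lemma pairs_op_subproof (f : symb S) (a : 'I_(arity f) -> pairs) :
  al (op (fun i => (sval (a i)).1)) (op (fun i => (sval (a i)).2)).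
Proof. by case: cal => _ _ _; apply=> i; exact: (svalP (a i)). Qed.

Definition pairs_algebra : algebra S :=
  @Algebra S pairs (fun f a => pair_of (pairs_op_subproof a)).

Lemma eval_pairs (X : Type) (env : X -> pairs_algebra) (t : term S X) :
  sval (eval env t) =
  (eval (fun v => (sval (env v)).1) t, eval (fun v => (sval (env v)).2) t).
Proof.
elim: t => [v|f args IH] /=; first by case: (sval _).
by congr (_, _); congr op; apply: functional_extensionality => i; rewrite IH.
Qed.

Lemma pairs_models (Sigma : identity S -> Prop) :
  models A Sigma -> models pairs_algebra Sigma.
Proof.
move=> mA e Se env.
have : sval (eval env e.1) = sval (eval env e.2).
  by rewrite !eval_pairs; congr (_, _); exact: mA.
case: (eval env e.1) (eval env e.2) => [u pu] [v pv] /= uv.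
by case: v / uv pv => pv; congr exist; exact: proof_irrelevance.
Qed.

Lemma eval3_pairs (p : term S 'I_3) (X Y Z : pairs_algebra) :
  sval (eval3 p X Y Z) =
  (eval3 p (sval X).1 (sval Y).1 (sval Z).1,
   eval3 p (sval X).2 (sval Y).2 (sval Z).2).
Proof.
rewrite /eval3 eval_pairs.
by congr (_, _); apply: eval_ext => -[[|[|k]] lt_k].
Qed.

Variables (be : A -> A -> Prop) (T : A -> A -> A -> A -> Prop).
Hypotheses (cbe : is_congruence be) (msT : matrix_system al be T).
Hypothesis T_htrans :
  forall x y u v z w, T x y u v -> T u v z w -> T x y z w.
Hypothesis T_vtrans :
  forall x y z w y' w', T x y z w -> T y y' w w' -> T x y' z w'.

Definition pairs_be (X Y : pairs_algebra) : Prop :=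
  be (sval X).1 (sval Y).1 /\ be (sval X).2 (sval Y).2.

Definition pairs_T (X Y : pairs_algebra) : Prop :=
  T (sval X).1 (sval X).2 (sval Y).1 (sval Y).2.

Lemma pairs_be_congruence : is_congruence pairs_be.
Proof.
have [be_refl be_sym be_trans be_op] := cbe.
split.
- by [].
- by move=> X Y [h1 h2]; split; exact: be_sym.
- by move=> X Y Z [h1 h2] [k1 k2]; split; [exact: be_trans k1 | exact: be_trans k2].
- by move=> f a b h; split; apply: be_op => i; case: (h i).
Qed.

Lemma pairs_T_congruence : is_congruence pairs_T.
Proof.
split.
- by move=> X; exact: ms_al msT _ _ (svalP X).
- by move=> X Y; exact: (ms_cols msT).
- by move=> X Y Z; exact: T_htrans.
- by move=> f a b h; exact: ms_op msT _ _ _ _ _ h.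
Qed.

Lemma pairs_be_centralizes : centralizes pairs_be pairs_be pairs_T.
Proof.
have [al_refl al_sym _ _] := cal.
move=> m n t a b c d hab hcd.
rewrite /pairs_T !eval_pairs /= => h.
(* The flags [k] and [l] choose the coordinate separately for the two groups of variables, so that
   [e] can be replaced by (e2, e2) while [g] stays intact. *)
pose ev (k l : bool) (e : 'I_m -> pairs) (g : 'I_n -> pairs) :=
  eval (sumenv (fun i => if k then (sval (e i)).2 else (sval (e i)).1)
               (fun j => if l then (sval (g j)).2 else (sval (g j)).1)) t.
have evE k e g : eval (fun v => if k then (sval (sumenv e g v)).2
    else (sval (sumenv e g v)).1) t = ev k k e g.
  by apply: eval_ext => -[i|j].
move: h.
rewrite !(evE false) !(evE true) => h.
(* Replace [a] by [(a2, a2)], then by [(b2, b2)], then by [b]. *)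
have h2 : T (ev true false a c) (ev true true a c)
            (ev true false a d) (ev true true a d).
  apply: T_vtrans h; apply: (ms_eval _ msT) => -[i|j] /=.
    by apply: (ms_al msT); apply: al_sym; exact: (svalP (a i)).
  by apply: (ms_be msT); case: (hcd j).
have hb g : T (ev true false a g) (ev true true a g)
              (ev true false b g) (ev true true b g).
  apply: (ms_eval _ msT) => -[i|j] /=.
    by apply: (ms_be msT); case: (hab i).
  by apply: (ms_al msT); exact: (svalP (g j)).
have h3 : T (ev true false b c) (ev true true b c)
            (ev true false b d) (ev true true b d).
  exact: T_htrans (ms_cols msT (hb c)) (T_htrans h2 (hb d)).
apply: T_vtrans h3; apply: (ms_eval _ msT) => -[i|j] /=.
  by apply: (ms_al msT); exact: (svalP (b i)).
by apply: (ms_be msT); case: (hcd j).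
Qed.

Lemma qmap_column (Sigma : identity S -> Prop) (p : term S 'I_3) (a b c d : A) :
  models A Sigma -> is_difference_term Sigma p ->
  inR al be a b c d -> T a b (qmap p a b c d) d.
Proof.
move=> mA dp [ab cd ac bd].
have [al_refl _ _ _] := cal; have cT := pairs_T_congruence.
have [T_refl T_sym T_trans _] := cT.
have [p_left_A _] := dp A mA.
have [p_left p_right] := dp _ (pairs_models mA).
(* With U = (b, b) and V = (d, d), the pair p(p(X,Y,Y), p(U,V,Y), Y) has first coordinate q(a,b,c,d)
   and second coordinate p(p(b,d,d), p(b,d,d), d) = d. Modulo [pairs_T] it reduces to p(p(X,Y,Y), Y,
   Y), and then to X. *)
pose X := pair_of ab : pairs_algebra; pose Y := pair_of cd : pairs_algebra.
pose U := pair_of (al_refl b) : pairs_algebra.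
pose V := pair_of (al_refl d) : pairs_algebra.
have XY : pairs_T (eval3 p X Y Y) X.
  have := p_right _ pairs_be_congruence X Y (conj ac bd).
  by apply; [exact: cT | exact: pairs_be_centralizes].
have XY2 : pairs_T (eval3 p (eval3 p X Y Y) Y Y) X.
  exact: T_trans (congruence_eval3 p cT XY (T_refl Y) (T_refl Y)) XY.
have UV : pairs_T (eval3 p U V Y) Y.
  rewrite -[X in pairs_T _ X](p_left V Y).
  have UV : pairs_T U V := ms_be msT bd.
  exact: (congruence_eval3 p cT UV (T_refl V) (T_refl Y)).
have : pairs_T X (eval3 p (eval3 p X Y Y) (eval3 p U V Y) Y).
  by apply/T_sym/(T_trans _ _ _ _ XY2)/(congruence_eval3 p cT _ UV (T_refl Y)).
by rewrite /pairs_T /qmap !eval3_pairs /= p_left_A.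
Qed.

End Pairs.

Theorem theorem1p1 (S : signature) (Sigma : identity S -> Prop) (p : term S 'I_3)
  (A : algebra S) (al be : A -> A -> Prop) :
  is_difference_term Sigma p ->
  @models S A Sigma ->
  @is_congruence S A al -> @is_congruence S A be ->
  (forall x y : A, @commutator S A al be x y -> x = y) ->
  forall (f : symb S) (a b c d : 'I_(arity f) -> A),
    (forall i, inR al be (a i) (b i) (c i) (d i)) ->
    qmap p (@op S A f a) (@op S A f b) (@op S A f c) (@op S A f d)
    = @op S A f (fun i => qmap p (a i) (b i) (c i) (d i)).
Proof.
move=> dp mA cal cbe com0 f a b c d habcd.
have [p_left p_diff] := dp A mA.
have [al_refl al_sym al_trans al_op] := cal.
have [be_refl be_sym be_trans be_op] := cbe.
(* For the intersection [mu] of [al] and [be], monotonicity puts [mu, mu] below [al, be] = 0. *)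
have p_right (x y : A) : al x y -> be x y -> eval3 p x y y = x.
  move=> axy bxy; apply: com0; pose mu u v := al u v /\ be u v.
  have cmu : is_congruence mu.
    split=> //.
    - by move=> u v [? ?]; split; [exact: al_sym | exact: be_sym].
    - by move=> u v w [h1 h2] [k1 k2]; split; [exact: al_trans k1 | exact: be_trans k2].
    - by move=> g u v h; split; [apply: al_op | apply: be_op] => i; case: (h i).
  by apply: commutator_mono (p_diff mu cmu x y (conj axy bxy)) => u v [].
have ms0 := matrices_system cal cbe com0.
have msT := matrix_system_closure p_left cal cbe p_right ms0.
have htrans := closure_htrans p_left cal cbe p_right ms0.
have vtrans := closure_vtrans p_left cal cbe p_right ms0.
have qcol := qmap_column cal cbe msT htrans vtrans mA dp.
have fR : inR al be (op a) (op b) (op c) (op d).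
  by split; [apply: al_op | apply: al_op | apply: be_op | apply: be_op] => i;
     case: (habcd i).
have qf := ms_op msT (fun i => qcol _ _ _ _ (habcd i)).
have fq := qcol _ _ _ _ fR.
(* Both matrices have the column (f(a), f(b)). Pasting along it gives a matrix with constant bottom
   row f(d), whose top row consists of the two sides of the equation. *)
exact: ms_uniq msT _ _ _ (ms_rows msT (htrans _ _ _ _ _ _ (ms_cols msT fq) qf)).
Qed.
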